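(* Let $L$ be a transitive permutation group and let $L_\omega$ be a point-stabiliser in $L$. Then $L$ is $f$-graph-restrictive, where $f(n) = |L_\omega|^{\frac{n-2}{2}}$. In particular, $L$ is $\mathrm{Exp}$-graph-restrictive.
   Context: All graphs are finite, simple and connected. For a graph $\Gamma$, a vertex $v$ and $G\le \mathrm{Aut}(\Gamma)$, $\Gamma(v)$ denotes the neighbourhood of $v$ and $G_v^{\Gamma(v)}$ the permutation group induced by the vertex-stabiliser $G_v$ on $\Gamma(v)$. $\Gamma$ is $G$-arc-transitive if $G\le\mathrm{Aut}(\Gamma)$ acts transitively on arcs (ordered pairs of adjacent vertices). A pair $(\Gamma,G)$ is locally-$L$ if $\Gamma$ is $G$-arc-transitive and $G_v^{\Gamma(v)}$ is permutation isomorphic to $L$. For a function $f:\mathbb N\to\mathbb R$, a transitive permutation group $L$ is $f$-graph-restrictive if for every locally-$L$ pair $(\Gamma,G)$ and every arc $(u,v)$ of $\Gamma$ we have $|G_{uv}|\le f(|\mathrm V(\Gamma)|)$. $\mathrm{Exp}$ is the class of functions $f(n)=\alpha^n$ with $\alpha>1$; $L$ is $\mathrm{Exp}$-graph-restrictive if it is $f$-graph-restrictive for some $f\in\mathrm{Exp}$. *)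

(* Defs.v *)
From mathcomp Require Import all_boot all_order all_algebra all_fingroup.
From mathcomp Require Import reals exp.

Set Implicit Arguments.
Unset Strict Implicit.
Unset Printing Implicit Defensive.

Import GroupScope Num.Theory.

Record graph := Graph {
  vertex :> finType;
  adj : rel vertex;
  adj_sym : symmetric adj;
  adj_irr : irreflexive adj;
  adj_connected : forall x y, connect adj x y
}.

Definition neighbourhood (Gamma : graph) (v : Gamma) : {set Gamma} :=
  [set w | adj v w].

Definition graph_aut (Gamma : graph) : {set {perm Gamma}} :=
  [set g : {perm Gamma} | [forall x, forall y, adj (g x) (g y) == adj x y]].

Definition arc_transitive (Gamma : graph) (G : {group {perm Gamma}}) : Prop :=
  G \subset graph_aut Gamma /\
  forall u v x y : Gamma, adj u v -> adj x y ->
    exists2 g, g \in G & g u = x /\ g v = y.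

(* The action 'P^? restricts permutations preserving the neighbourhood of v to
   permutations of the subtype of neighbours of v; the stabiliser of v in G
   lies in its domain as soon as G consists of automorphisms. *)
Definition local_group (Gamma : graph) (G : {group {perm Gamma}}) (v : Gamma) :
    {group {perm {w : Gamma | w \in neighbourhood v}}} :=
  (actperm ('P^?) @* 'C_G[v | 'P])%G.

Definition perm_isomorphic (S T : finType)
    (A : {group {perm S}}) (B : {group {perm T}}) : Prop :=
  exists (beta : S -> T) (phi : {morphism A >-> {perm T}}),
    [/\ bijective beta, isom A B phi &
        forall a x, a \in A -> beta (a x) = phi a (beta x)].

Definition locally (Omega : finType) (L : {group {perm Omega}})
    (Gamma : graph) (G : {group {perm Gamma}}) : Prop :=
  arc_transitive G /\ forall v : Gamma, perm_isomorphic (local_group G v) L.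

Local Open Scope ring_scope.

Definition graph_restrictive (R : realType) (f : nat -> R)
    (Omega : finType) (L : {group {perm Omega}}) : Prop :=
  forall (Gamma : graph) (G : {group {perm Gamma}}), locally L G ->
  forall u v : Gamma, adj u v ->
    #|('C_G([set u; v] | 'P))%g|%:R <= f #|Gamma|.

Definition Exp (R : realType) (f : nat -> R) : Prop :=
  exists2 alpha : R, 1 < alpha & forall n, f n = alpha ^+ n.

Definition class_graph_restrictive (R : realType) (F : (nat -> R) -> Prop)
    (Omega : finType) (L : {group {perm Omega}}) : Prop :=
  exists2 f, F f & graph_restrictive f L.

(* Main.v *)
(** Write [G_X] for the pointwise stabiliser of a set [X] of vertices in which
    every vertex has a neighbour in [X].  For [x] in [X], the group [G_X] induces
    on the neighbourhood of [x] a subgroup of a point-stabiliser of the local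
    group, so enlarging [X] by that neighbourhood divides the order of [G_X] by at
    most [m = |L_omega|].  If [G_X] moves some neighbour of [x], then a nontrivial
    orbit lies outside [X], so [X] gains at least two vertices; otherwise [G_X]
    does not change.  Induction on [n - |X|] gives [|G_X|^2 <= m^(n - |X|)], and
    the theorem is the case [X = {u, v}]. *)

Require Import Defs.
From mathcomp Require Import all_boot all_order all_algebra all_fingroup.
From mathcomp Require Import reals exp zify.

Import GRing.Theory Num.Theory.

Section StabiliserGrowth.
Local Open Scope group_scope.

Lemma card_astab1_transitive {Omega : finType} (L : {group {perm Omega}})
    (a b : Omega) :
  [transitive L, on [set: Omega] | 'P] -> #|'C_L[a | 'P]| = #|'C_L[b | 'P]|.
Proof.
move=> Ltrans.
have index_stab c : #|L : 'C_L[c | 'P]| = #|Omega|.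
  by rewrite -card_orbit (atransP Ltrans) ?inE // cardsT.
have := Lagrange (subsetIl L 'C[b | 'P]).
rewrite -(Lagrange (subsetIl L 'C[a | 'P])) !index_stab => /eqP.
by rewrite eqn_pmul2r => [/eqP|]; last by apply/card_gt0P; exists a.
Qed.

(** With [y] the image of [x] under the bijection, [phi] embeds the stabiliser of [x] into that of
    [y]. Which [y] occurs does not matter once [B] is transitive. *)
Lemma perm_isomorphic_card_astab1 {S T : finType} {A : {group {perm S}}}
    {B : {group {perm T}}} (x : S) :
  perm_isomorphic A B -> exists y : T, #|'C_A[x | 'P]| <= #|'C_B[y | 'P]|.
Proof.
case=> beta [phi [_ isoAB phiE]]; exists (beta x).
have [injphi imphi] := isomP isoAB.
rewrite -(card_injm injphi (subsetIl A _)); apply/subset_leq_card/subsetP => z.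
case/morphimP => a Aa /setIP[_ /astab1P fixa] ->.
rewrite inE -{1}imphi mem_morphim //=; apply/astab1P.
by rewrite /= apermE -phiE // -{2}fixa.
Qed.

Section Graph.
Context {Gamma : graph} {G : {group {perm Gamma}}}.
Hypothesis autG : G \subset graph_aut Gamma.
Implicit Types (X : {set Gamma}) (x y z : Gamma).

Lemma adj_aut g x y : g \in G -> adj (g x) (g y) = adj x y.
Proof.
by move=> /(subsetP autG); rewrite inE => /forallP/(_ x)/forallP/(_ y)/eqP.
Qed.

(** Outside its domain ['P^?] acts trivially by default; on the stabiliser of [x] it is the genuine
    restriction to the neighbours of [x]. *)
Lemma astab1_sub_subact_dom x :
  'C_G[x | 'P] \subset subact_dom (mem (neighbourhood x)) 'P.
Proof.
apply/subsetP => g /setIP[Gg /astab1P /= gx].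
rewrite inE in_setT inE /=; apply/subsetP => y; rewrite !inE /= => xy.
by rewrite -{1}gx /= !apermE adj_aut.
Qed.

(** First isomorphism theorem for the action of the fixator of [X] on the neighbours of [x]: the
    image fixes [y], so it lies in a point-stabiliser of the local group, and the kernel fixes the
    neighbours as well as [X]. *)
Lemma leq_card_astab_setU {m x y X} :
  (forall w : {w : Gamma | w \in neighbourhood x},
     #|'C_(local_group G x)[w | 'P]| <= m) ->
  x \in X -> y \in X -> adj x y ->
  #|'C_G(X | 'P)| <= m * #|'C_G(X :|: neighbourhood x | 'P)|.
Proof.
move=> lem Xx Xy xy.
pose f := actperm ('P^? : action _ {w : Gamma | w \in neighbourhood x}).
have sXx : 'C_G(X | 'P) \subset 'C_G[x | 'P].
  by apply/setIS/astabS; rewrite sub1set.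
have sXd := subset_trans sXx (astab1_sub_subact_dom x).
have fE g (w : {w : Gamma | w \in neighbourhood x}) :
  g \in 'C_G(X | 'P) -> val (f g w) = g (val w).
  move=> /(subsetP sXd) dg; rewrite actpermE /= val_subact dg //.
have ywP : y \in neighbourhood x by rewrite inE.
pose yw : {w : Gamma | w \in neighbourhood x} := Sub y ywP.
have im_le : #|f @* 'C_G(X | 'P)| <= m.
  apply: leq_trans (lem yw); apply/subset_leq_card/subsetP => z zf.
  rewrite inE (subsetP (morphimS _ sXx)) //=; apply/astab1P.
  case/morphimP: zf => g dg Xg ->; apply: val_inj; rewrite /= apermE fE //=.
  by case/setIP: Xg => _ /astabP/(_ y Xy).
have ker_sub : 'ker_('C_G(X | 'P)) f \subset 'C_G(X :|: neighbourhood x | 'P).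
  apply/subsetP => g /setIP[Xg kg]; have [Gg gX] := setIP Xg.
  rewrite inE Gg /=; apply/astabP => z /setUP[/(astabP gX)//|xz] /=.
  have fg1 : f g = 1 := mker kg.
  by rewrite apermE -(fE g (Sub z xz) Xg) fg1 perm1.
rewrite -(LagrangeI _ ('ker f)) mulnC.
apply: leq_mul (subset_leq_card ker_sub).
by move: im_le; rewrite card_morphim (setIidPr sXd).
Qed.

Lemma leq_card_neighbourhoodU x X :
  x \in X -> ~~ ('C_G(X | 'P) \subset 'C(neighbourhood x | 'P)) ->
  #|X|.+2 <= #|X :|: neighbourhood x|.
Proof.
move=> Xx /subsetPn[g Xg /astabP ngx]; have [Gg gX] := setIP Xg.
have [z xz gz] : exists2 z, z \in neighbourhood x & g z != z.
  apply/exists_inP; apply: contra_notT ngx => /exists_inPn fixg z /fixg.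
  by rewrite negbK => /eqP.
have fixX w : w \in X -> g w = w by move/(astabP gX).
have gzx : g z \in neighbourhood x.
  by move: xz; rewrite !inE -{2}(fixX x Xx) adj_aut.
have zX : z \notin X by apply: contra gz => /fixX ->.
(* If [g] fixed [g z], injectivity would give [g z = z]. *)
have gzX : g z \notin X by apply: contra gz => /fixX/perm_inj ->.
rewrite -(cardsID X (X :|: _)) (setIidPr (subsetUl _ _)) -addn2 leq_add2l.
have -> : 2 = #|[set g z; z]| by rewrite cards2 gz.
apply/subset_leq_card/subsetP => w /set2P[] ->.
  by rewrite inE gzX inE gzx orbT.
by rewrite inE zX inE xz orbT.
Qed.

Lemma connected_closed_setT X :
  X != set0 -> (forall x, x \in X -> neighbourhood x \subset X) -> X = setT.
Proof.
case/set0Pn=> x Xx clX; apply/setP => y; rewrite in_setT.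
have clos : closed (@adj Gamma) (mem X).
  move=> a b ab; apply/idP/idP => [/clX|/clX] /subsetP; apply.
    by rewrite inE.
  by rewrite inE adj_sym.
by rewrite -(closed_connect clos (adj_connected x y)).
Qed.

(** Squaring keeps the exponent integral: a factor [m] lost in the order becomes [m ^ 2], paid for
    by two new vertices. *)
Lemma sqrn_card_astab_leq (m : nat) X :
  (forall x (w : {w : Gamma | w \in neighbourhood x}),
     #|'C_(local_group G x)[w | 'P]| <= m) ->
  X != set0 -> (forall x, x \in X -> exists2 y, y \in X & adj x y) ->
  #|'C_G(X | 'P)| ^ 2 <= m ^ (#|Gamma| - #|X|).
Proof.
move=> lem.
have [k] := ubnP (#|Gamma| - #|X|); elim: k X => // k IHk X ltk X0 nbX.
have [x0 Xx0] := set0Pn _ X0; have [y0 Xy0 xy0] := nbX _ Xx0.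
have m_gt0 : 0 < m.
  have y0P : y0 \in neighbourhood x0 by rewrite inE.
  exact: leq_trans (cardG_gt0 _) (lem x0 (Sub y0 y0P)).
(* The neighbour condition survives the enlargement, since each added vertex is adjacent to [x]. *)
have nbXU x : x \in X -> forall z, z \in X :|: neighbourhood x ->
    exists2 y, y \in X :|: neighbourhood x & adj z y.
  move=> Xx z /setUP[/nbX[y Xy zy]|]; first by exists y; rewrite // inE Xy.
  by rewrite inE => xz; exists x; [rewrite inE Xx | rewrite adj_sym].
have XU0 x : X :|: neighbourhood x != set0.
  by apply/set0Pn; exists x0; rewrite inE Xx0.
have [/exists_inP[x Xx nfix]|] :=
  boolP [exists x in X, ~~ ('C_G(X | 'P) \subset 'C(neighbourhood x | 'P))].
  have [y Xy xy] := nbX x Xx.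
  have cardU := leq_card_neighbourhoodU _ _ Xx nfix.
  have cardUT : #|X :|: neighbourhood x| <= #|Gamma| := max_card _.
  have {}IHk := IHk (X :|: neighbourhood x) _ (XU0 x) (nbXU x Xx).
  apply: leq_trans (_ : (m * #|'C_G(X :|: neighbourhood x | 'P)|) ^ 2 <= _).
    by rewrite leq_exp2r // (leq_card_astab_setU (lem x) Xx Xy xy).
  rewrite expnMn.
  apply: (@leq_trans (m ^ (2 + (#|Gamma| - #|X :|: neighbourhood x|)))).
    by rewrite expnD leq_mul // IHk //; lia.
  by apply: leq_pexp2l => //; lia.
move/exists_inPn => fixX.
(* The fixator of [X] now fixes all neighbours of [X], so adding some of them leaves it unchanged
   and only lowers the exponent. *)
have [/exists_inP[x Xx nsub]|] := boolP [exists x in X, ~~ (neighbourhood x \subset X)].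
  have cardU : #|X| < #|X :|: neighbourhood x|.
    apply/proper_card; rewrite properE subsetUl subUset subxx.
    by rewrite (negPf nsub).
  have cardUT : #|X :|: neighbourhood x| <= #|Gamma| := max_card _.
  have -> : 'C_G(X | 'P) = 'C_G(X :|: neighbourhood x | 'P).
    have := fixX x Xx; rewrite negbK => /setIidPl.
    by rewrite -setIA -astabU => ->.
  apply: leq_trans (IHk (X :|: neighbourhood x) _ (XU0 x) (nbXU x Xx)) _; first lia.
  by apply: leq_pexp2l => //; lia.
(* No edge leaves [X], so by connectedness [X] is everything and its fixator is trivial. *)
move/exists_inPn => clX.
have -> : X = setT.
  by apply: connected_closed_setT => // x /clX; rewrite negbK.
suff -> : 'C_G(setT | 'P) = 1 by rewrite cards1 expn_gt0 m_gt0.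
apply/trivgP/subsetP => g /setIP[_ /astabP gfix].
by rewrite inE; apply/eqP/permP => x; rewrite perm1; apply: gfix.
Qed.

End Graph.

Lemma locally_sqrn_card_arc_stab {Omega : finType} (L : {group {perm Omega}})
    (omega : Omega) (Gamma : graph) (G : {group {perm Gamma}}) (u v : Gamma) :
  [transitive L, on [set: Omega] | 'P] -> locally L G -> adj u v ->
  #|'C_G([set u; v] | 'P)| ^ 2 <= #|'C_L[omega | 'P]| ^ (#|Gamma| - 2).
Proof.
move=> Ltrans [[autG _] locG] uv.
have uDv : u != v by apply: contraTneq uv => ->; rewrite adj_irr.
have card_arc : #|[set u; v]| = 2 by rewrite cards2 uDv.
rewrite -[X in _ - X]card_arc; apply: (sqrn_card_astab_leq autG).
- move=> x w; have [y /leq_trans] := perm_isomorphic_card_astab1 w (locG x).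
  by apply; rewrite (card_astab1_transitive _ y omega).
- by apply/set0Pn; exists u; rewrite !inE eqxx.
move=> x /set2P[] ->; first by exists v; rewrite // !inE eqxx orbT.
by exists u; [rewrite !inE eqxx | rewrite adj_sym].
Qed.

End StabiliserGrowth.

Local Open Scope ring_scope.

Theorem theorem2p1 (R : realType) (Omega : finType) (L : {group {perm Omega}})
    (Ltrans : [transitive L, on [set: Omega] | 'P]) (omega : Omega) :
  graph_restrictive
    (fun n : nat => (#|('C_L[omega | 'P])%g|%:R : R) `^ ((n%:R - 2%:R) / 2%:R)) L /\
  class_graph_restrictive (@Exp R) L.
Proof.
set m := #|('C_L[omega | 'P])%g|.
have m_gt0 : (0 < m)%N by exact: cardG_gt0.
split.
  move=> Gamma G locG u v uv.
  have leC := locally_sqrn_card_arc_stab L omega Gamma G u v Ltrans locG uv.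
  have uDv : u != v by apply: contraTneq uv => ->; rewrite adj_irr.
  (* This makes the truncated difference [#|Gamma| - 2] agree with the real one. *)
  have n_ge2 : (2 <= #|Gamma|)%N.
    have <- : #|[set u; v]| = 2%N by rewrite cards2 uDv.
    exact: max_card.
  rewrite -(@ler_pXn2r _ 2) ?nnegrE ?powR_ge0 ?ler0n //.
  rewrite -(powR_mulrn 2 (powR_ge0 _ _)) -powRrM divfK ?pnatr_eq0 //.
  by rewrite -natrB // powR_mulrn ?ler0n // -!natrX ler_nat.
(* The base is [m.+1] because [m] may be 1, while [Exp] demands a base above 1. *)
exists (fun n => m.+1%:R ^+ n); first by exists m.+1%:R; rewrite ?ltr1n.
move=> Gamma G locG u v uv.
have leC := locally_sqrn_card_arc_stab L omega Gamma G u v Ltrans locG uv.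
rewrite -natrX ler_nat.
(* With [c] the order of the arc-stabiliser and [n] the number of vertices, [c <= c ^ 2 <= m ^ (n -
   2) <= m ^ n <= m.+1 ^ n]. *)
apply: leq_trans (leq_trans leC _).
  by rewrite -{1}(expn1 #|_|) leq_pexp2l // cardG_gt0.
apply: (@leq_trans (m ^ #|Gamma|)); first by rewrite leq_pexp2l // leq_subr.
by rewrite leq_exp2r //; apply/card_gt0P; exists u.
Qed.
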